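(* Let $\mathbb{I}=(I,\le,\mathcal{I})$ be a set of indices, let $\mathcal{J}\subseteq\mathcal{I}$ be a nonempty subset such that for all $A,B\in\mathcal{J}$ there is $C\in\mathcal{J}$ with $C\subseteq A\cap B$, and let $(x_\varepsilon),(y_\varepsilon),(z_\varepsilon)\in\mathbb{R}^I$ be nets of real numbers. Then, as $\varepsilon\in\mathbb{I}$: (i) $x_\varepsilon=O_{\mathcal{J}}(x_\varepsilon)$; (ii) if $x_\varepsilon=O_{\mathcal{J}}(y_\varepsilon)$ and $y_\varepsilon=O_{\mathcal{J}}(z_\varepsilon)$, then $x_\varepsilon=O_{\mathcal{J}}(z_\varepsilon)$; (iii) $O_{\mathcal{J}}(x_\varepsilon)\cdot O_{\mathcal{J}}(y_\varepsilon)=O_{\mathcal{J}}(x_\varepsilon\cdot y_\varepsilon)$; (iv) $O_{\mathcal{J}}(x_\varepsilon)+O_{\mathcal{J}}(y_\varepsilon)=O_{\mathcal{J}}(|x_\varepsilon|+|y_\varepsilon|)$; (v) $x_\varepsilon\cdot O_{\mathcal{J}}(y_\varepsilon)=O_{\mathcal{J}}(x_\varepsilon\cdot y_\varepsilon)$; (vi) $O_{\mathcal{J}}(x_\varepsilon)+O_{\mathcal{J}}(x_\varepsilon)=O_{\mathcal{J}}(x_\varepsilon)$; (vii) if $x_\varepsilon,y_\varepsilon\ge 0$ for all $\varepsilon\in I$, then $x_\varepsilon+O_{\mathcal{J}}(y_\varepsilon)=O_{\mathcal{J}}(x_\varepsilon+y_\varepsilon)$; (viii) for all $k\in\mathbb{R}$: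 $O_{\mathcal{J}}(k\cdot x_\varepsilon)=O_{\mathcal{J}}(x_\varepsilon)$; (ix) for all $k\in\mathbb{R}$: $k\cdot O_{\mathcal{J}}(x_\varepsilon)=O_{\mathcal{J}}(x_\varepsilon)$.
   Context: A set of indices is a triple $\mathbb{I}=(I,\le,\mathcal{I})$ such that: (1) $I$ is a nonempty set and $\le$ is a reflexive and transitive relation on $I$; (2) $\mathcal{I}$ is a set of subsets of $I$ with $\emptyset\notin\mathcal{I}$ and $I\in\mathcal{I}$; (3) for all $A,B\in\mathcal{I}$ there is $C\in\mathcal{I}$ with $C\subseteq A\cap B$; (4) writing $(\emptyset,e]:=\{\varepsilon\in I\mid\varepsilon\le e\}$, $A_{\le e}:=(\emptyset,e]\cap A$, and $\varepsilon<e$ for ''$\varepsilon\le e$ and $\varepsilon\neq e$'': whenever $e\le a\in A\in\mathcal{I}$, the set $A_{\le e}$ is nonempty and for all $b,c\in A_{\le e}$ there is $d\in A_{\le e}$ with $d<b$ and $d<c$. (It is not required that $e\in A$.) For $a\in A\in\mathcal{I}$, one writes $x_\varepsilon=O_{a,A}(y_\varepsilon)$ if there exist $H\in\mathbb{R}_{>0}$ and $\varepsilon_0\in A_{\le a}$ such that $|x_\varepsilon|\le H\cdot|y_\varepsilon|$ for all $\varepsilon\in A_{\le\varepsilon_0}$. One writes $x_\varepsilon=O_{\mathcal{J}}(y_\varepsilon)$ as $\varepsilon\in\mathbb{I}$ if there exists $A\in\mathcal{J}$ such that for all $a\in A$: $x_\varepsilon=O_{a,A}(y_\varepsilon)$.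 Equalities between big-O expressions are read from left to right: e.g. (iii) means that if $x'_\varepsilon=O_{\mathcal{J}}(x_\varepsilon)$ and $y'_\varepsilon=O_{\mathcal{J}}(y_\varepsilon)$ then $x'_\varepsilon y'_\varepsilon=O_{\mathcal{J}}(x_\varepsilon y_\varepsilon)$; (viii) means that $x'_\varepsilon=O_{\mathcal{J}}(kx_\varepsilon)$ implies $x'_\varepsilon=O_{\mathcal{J}}(x_\varepsilon)$; and similarly for the others. *)

(* Defs.v *)
From mathcomp Require Import all_boot all_order all_algebra.
From mathcomp Require Import classical_sets reals.

Set Implicit Arguments.
Unset Strict Implicit.
Unset Printing Implicit Defensive.

Import Order.TTheory GRing.Theory Num.Theory.
Local Open Scope classical_set_scope.
Local Open Scope ring_scope.

(* A_{<= e}; the bound e is not required to belong to A. *)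
Definition below (I : Type) (le : I -> I -> Prop) (A : set I) (e : I) : set I :=
  [set i | le i e] `&` A.

(* The relation [le] need not be antisymmetric, so i < e may hold together with
   e < i; "i < e" only means "i <= e and i <> e". *)
Definition strict (I : Type) (le : I -> I -> Prop) (i e : I) : Prop :=
  le i e /\ i <> e.

Definition downward_directed (I : Type) (F : set (set I)) : Prop :=
  forall A B : set I, F A -> F B -> exists2 C, F C & C `<=` A `&` B.

Record set_of_indices (I : Type) (le : I -> I -> Prop) (F : set (set I)) :
    Prop := SetOfIndices {
  indices_nonempty : inhabited I;
  indices_refl : forall i, le i i;
  indices_trans : forall i j k, le i j -> le j k -> le i k;
  indices_set0 : ~ F set0;
  indices_setT : F setT;
  indices_directed : downward_directed F;
  indices_below_nonempty : forall (A : set I) (a e : I),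
    F A -> A a -> le e a -> below le A e !=set0;
  indices_below_strict : forall (A : set I) (a e : I),
    F A -> A a -> le e a ->
    forall b c, below le A e b -> below le A e c ->
    exists d, [/\ below le A e d, strict le d b & strict le d c]
}.

Definition bigO_at (R : realType) (I : Type) (le : I -> I -> Prop)
    (A : set I) (a : I) (x y : I -> R) : Prop :=
  exists H : R, 0 < H /\
  exists e0 : I, below le A a e0 /\
  forall e : I, below le A e0 e -> `|x e| <= H * `|y e|.

(* [bigO le J x y] reads "x_e = O_J(y_e)"; H and e0 in [bigO_at] may depend on
   the point a of A. *)
Definition bigO (R : realType) (I : Type) (le : I -> I -> Prop)
    (J : set (set I)) (x y : I -> R) : Prop :=
  exists A : set I, J A /\ forall a : I, A a -> bigO_at le A a x y.

(* Main.v *)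
(* The only delicate point is to make two O-estimates hold at once: given c in
   C `<=` A `&` B, the estimate on A at c holds below some e1 <= c in A; the
   estimate on B is then applied not at c but at a point of C below e1, and
   gives some e2. Both estimates hold below any point of C under e2, and what
   remains is pointwise algebra with the constants. *)
Require Import Defs.
From mathcomp Require Import all_boot all_order all_algebra.
From mathcomp Require Import classical_sets reals.

Set Implicit Arguments.
Unset Strict Implicit.
Unset Printing Implicit Defensive.

Import Order.TTheory GRing.Theory Num.Theory.
Local Open Scope classical_set_scope.
Local Open Scope ring_scope.

Section BigO.
Variables (R : realType) (I : Type) (le : I -> I -> Prop) (F J : set (set I)).
Hypotheses (hI : set_of_indices le F) (hJF : J `<=` F).
Hypotheses (hJ0 : J !=set0) (hJ : downward_directed J).
Implicit Types x y u v : I -> R.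

Lemma bigO_refl x : bigO le J x x.
Proof.
have [A JA] := hJ0; exists A; split=> // a Aa; exists 1; split=> //.
exists a; split; first by split=> //; exact: indices_refl hI a.
by move=> e _; rewrite mul1r.
Qed.

(** Reduces every rule with two O-hypotheses to an inequality at a single index. The constant [L]
    may depend on [H] and [K], which vary with the point of [C], but must be uniform in [e]. *)
Lemma bigO_combine x' x y' y u v : bigO le J x' x -> bigO le J y' y ->
  (forall H K, 0 < H -> 0 < K -> exists2 L, 0 < L &
    forall e, `|x' e| <= H * `|x e| -> `|y' e| <= K * `|y e| ->
      `|u e| <= L * `|v e|) ->
  bigO le J u v.
Proof.
move=> [A [JA hA]] [B [JB hB]] huv.
have [C JC sCAB] := hJ JA JB.
have leT i j k : le i j -> le j k -> le i k := @indices_trans _ _ _ hI i j k.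
exists C; split=> // c Cc.
(* Here [e] need not lie in [C]: this is applied to thresholds known only to lie in [A] or in
   [B]. *)
have pointC e : le e c -> below le C e !=set0.
  exact: (indices_below_nonempty hI (hJF JC) Cc).
have [H [H0 [e1 [[/= le1c _] hH]]]] := hA c (sCAB c Cc).1.
have [c1 [/= lec1 Cc1]] := pointC e1 le1c.
have [K [K0 [e2 [[/= le2c1 _] hK]]]] := hB c1 (sCAB c1 Cc1).2.
have le21 : le e2 e1 by exact: leT _ _ _ le2c1 lec1.
(* The final threshold must itself belong to [C], so [e2] is replaced by a point of [C] below it. *)
have [c2 [/= lec2 Cc2]] := pointC e2 (leT _ _ _ le21 le1c).
have le2c : le c2 c := leT _ _ _ lec2 (leT _ _ _ le21 le1c).
have [L L0 hL] := huv H K H0 K0.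
exists L; split=> //; exists c2; split=> // e [/= lee Ce].
have [Ae Be] := sCAB e Ce.
have lee2 : le e e2 by exact: leT _ _ _ lee lec2.
apply: hL; last exact: hK.
by apply: hH; split=> //; exact: leT _ _ _ lee2 le21.
Qed.

Lemma bigO_trans x y z : bigO le J x y -> bigO le J y z -> bigO le J x z.
Proof.
move=> xy yz; apply: (bigO_combine xy yz) => H K H0 K0.
exists (H * K); first exact: mulr_gt0.
by move=> e hx hy; apply: (le_trans hx); rewrite -mulrA ler_pM2l.
Qed.

Lemma bigO_mul x' x y' y : bigO le J x' x -> bigO le J y' y ->
  bigO le J (fun e => x' e * y' e) (fun e => x e * y e).
Proof.
move=> xx yy; apply: (bigO_combine xx yy) => H K H0 K0.
exists (H * K); first exact: mulr_gt0.
by move=> e hx hy; rewrite !normrM mulrACA ler_pM.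
Qed.

Lemma bigO_add x' x y' y : bigO le J x' x -> bigO le J y' y ->
  bigO le J (fun e => x' e + y' e) (fun e => `|x e| + `|y e|).
Proof.
move=> xx yy; apply: (bigO_combine xx yy) => H K H0 K0.
exists (H + K); first exact: addr_gt0.
move=> e hx hy; rewrite [`| `|_| + _|]ger0_norm ?addr_ge0 //.
apply: le_trans (ler_normD _ _) _; apply: le_trans (lerD hx hy) _.
(* Termwise comparison: [H] and [K] are each at most [H + K]. *)
rewrite mulrDr lerD // ler_wpM2r //; first by rewrite lerDl ltW.
by rewrite lerDr ltW.
Qed.

(** The bound holds at every index, so the two reflexive estimates fed to [bigO_combine] only supply
    a set of [J] and thresholds. *)
Lemma bigO_bound L u v : 0 < L -> (forall e, `|u e| <= L * `|v e|) ->
  bigO le J u v.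
Proof.
move=> L0 huv; apply: (bigO_combine (bigO_refl u) (bigO_refl u)) => *.
by exists L.
Qed.

Lemma bigO_scale k x : bigO le J (fun e => k * x e) x.
Proof.
(* Adding 1 keeps the constant positive when [k = 0]. *)
apply: (@bigO_bound (`|k| + 1)); first by rewrite ltr_wpDl.
by move=> e; rewrite normrM ler_wpM2r // lerDl.
Qed.

End BigO.

Theorem theorem16 (R : realType) (I : Type) (le : I -> I -> Prop)
    (F : set (set I)) (hI : set_of_indices le F)
    (J : set (set I)) (hJF : J `<=` F) (hJ0 : J !=set0)
    (hJ : downward_directed J) (x y z : I -> R) :
  (* (i) *)
  bigO le J x x /\
  (* (ii) *)
  (bigO le J x y -> bigO le J y z -> bigO le J x z) /\
  (* (iii) *)
  (forall x' y' : I -> R, bigO le J x' x -> bigO le J y' y ->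
    bigO le J (fun e => x' e * y' e) (fun e => x e * y e)) /\
  (* (iv) *)
  (forall x' y' : I -> R, bigO le J x' x -> bigO le J y' y ->
    bigO le J (fun e => x' e + y' e) (fun e => `|x e| + `|y e|)) /\
  (* (v) *)
  (forall y' : I -> R, bigO le J y' y ->
    bigO le J (fun e => x e * y' e) (fun e => x e * y e)) /\
  (* (vi) *)
  (forall x' x'' : I -> R, bigO le J x' x -> bigO le J x'' x ->
    bigO le J (fun e => x' e + x'' e) x) /\
  (* (vii) *)
  ((forall e, 0 <= x e /\ 0 <= y e) ->
    forall y' : I -> R, bigO le J y' y ->
    bigO le J (fun e => x e + y' e) (fun e => x e + y e)) /\
  (* (viii) *)
  (forall (k : R) (x' : I -> R), bigO le J x' (fun e => k * x e) ->
    bigO le J x' x) /\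
  (* (ix) *)
  (forall (k : R) (x' : I -> R), bigO le J x' x ->
    bigO le J (fun e => k * x' e) x).
Proof.
have refl (w : I -> R) := bigO_refl hI hJ0 w.
have trans (u v w : I -> R) := @bigO_trans R I le F J hI hJF hJ u v w.
have bound := @bigO_bound R I le F J hI hJF hJ0 hJ.
have scale := @bigO_scale R I le F J hI hJF hJ0 hJ.
split; first exact: refl.
split; first exact: trans.
split; first by move=> x' y'; exact: (bigO_mul hI hJF hJ).
split; first by move=> x' y'; exact: (bigO_add hI hJF hJ).
split; first by move=> y'; exact: (bigO_mul hI hJF hJ (refl x)).
split.
  (* The sum rule gives the bound [|x| + |x|], which is [2 * |x|]. *)
  move=> x' x'' hx' hx''; apply: trans _ _ _ (bigO_add hI hJF hJ hx' hx'') _.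
  apply: (bound 2) => // e.
  by rewrite [`| `|_| + _|]ger0_norm ?addr_ge0 // mulr_natl.
split.
  (* Nonnegativity rules out cancellation in [x + y], turning [|x| + |y|] into [x + y]. *)
  move=> xy0 y' hy'; apply: trans _ _ _ (bigO_add hI hJF hJ (refl x) hy') _.
  apply: (bound 1) => // e; have [x0 y0] := xy0 e.
  by rewrite mul1r (ger0_norm x0) (ger0_norm y0).
(* Both scalar rules are transitivity with [scale], applied to [x] on the right here and to [x'] on
   the left in the last one. *)
split; first by move=> k x' hx'; exact: trans _ _ _ hx' (scale k x).
by move=> k x' hx'; exact: trans _ _ _ (scale k x') hx'.
Qed.
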